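(* Let $L$ be an algebraic $m$-distributive multiplicative lattice, and let $S$ be a subset of $C(L)$. Then the following conditions are equivalent: (1) $S$ is a saturated $m$-system; (2) the subspace $P(S):=\bigcap_{s\in S}\mathrm{D}(s)$ of $\mathrm{Spec}(L)$ is compact and $S=S_{P(S)}$.
   Context: A multiplicative lattice $(L,\vee,\cdot)$ is a complete lattice $L$ (least element $0$, largest element $1$) with a binary operation $\cdot\colon L\times L\to L$ such that $xy\leqslant x$ and $xy\leqslant y$ for all $x,y\in L$. It is $m$-distributive if $(x\vee y)z=xz\vee yz$ and $x(y\vee z)=xy\vee xz$ for all $x,y,z\in L$. $C(L)$ is the set of compact elements of $L$ (those $c$ such that $c\leqslant\bigvee X$ implies $c\leqslant\bigvee X_0$ for some finite $X_0\subseteq X$); $L$ is algebraic if every element is the join of a subset of $C(L)$. An element $p\neq 1$ of $L$ is prime if, for all $x,y\in L$, $xy\leqslant p$ implies $x\leqslant p$ or $y\leqslant p$. $\mathrm{Spec}(L)$ is the set of prime elements, with the Zariski topology, whose closed sets are the sets $\mathrm{V}(x):=\{p\in\mathrm{Spec}(L)\mid x\leqslant p\}$, $x\in L$; put $\mathrm{D}(x):=\mathrm{Spec}(L)\setminus\mathrm{V}(x)$. Compact means that every open cover has a finite subcover (no Hausdorff assumption). The intersection of the empty family of subsets of $\mathrm{Spec}(L)$ is $\mathrm{Spec}(L)$. An $m$-system in $L$ is a nonempty subset $S$ of $C(L)$ such that for all $x,y\in S$ there exists $z\in S$ with $z\leqslant xy$. It is saturated if $x\in S$, $c\in C(L)$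 and $x\leqslant c$ imply $c\in S$. For $Y\subseteq\mathrm{Spec}(L)$, $S_Y:=\{c\in C(L)\mid c\not\leqslant p\text{ for all }p\in Y\}$. *)

(* Defs.v *)
From HB Require Import structures.
From mathcomp Require Import all_boot all_order.
From mathcomp Require Import mathcomp_extra boolp classical_sets functions.
From mathcomp Require Import cardinality topology.

Set Implicit Arguments.
Unset Strict Implicit.
Unset Printing Implicit Defensive.

Import Order.TTheory.
Local Open Scope classical_set_scope.
Local Open Scope order_scope.

HB.mixin Record hasBigSup d T & Order.TBLattice d T := {
  bigsup : set T -> T;
  bigsupP : forall A : set T, isLub A (bigsup A)
}.

#[short(type="completeLatticeType")]
HB.structure Definition CompleteLattice d :=
  {T of Order.TBLattice d T & hasBigSup d T}.

(* No associativity, commutativity, unit or monotonicity is required. *)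
HB.mixin Record hasLatticeMul d T & CompleteLattice d T := {
  lmul : T -> T -> T;
  lmul_lel : forall x y : T, lmul x y <= x;
  lmul_ler : forall x y : T, lmul x y <= y
}.

#[short(type="mulLatticeType")]
HB.structure Definition MulLattice d :=
  {T of CompleteLattice d T & hasLatticeMul d T}.

Section CompactElements.
Context {d : Order.disp_t} (L : completeLatticeType d).

Definition compact_element : set L :=
  [set c | forall X : set L, c <= bigsup X ->
    exists X0 : set L, [/\ X0 `<=` X, finite_set X0 & c <= bigsup X0]].

Definition algebraic_lattice : Prop :=
  forall x : L, exists2 X : set L, X `<=` compact_element & x = bigsup X.

End CompactElements.

Arguments compact_element {d} L _.

Section MulLatticeDefs.
Context {d : Order.disp_t} (L : mulLatticeType d).

Definition m_distributive : Prop :=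
  (forall x y z : L, lmul (x `|` y) z = lmul x z `|` lmul y z) /\
  (forall x y z : L, lmul x (y `|` z) = lmul x y `|` lmul x z).

Definition prime_element : set L :=
  [set p | p <> \top /\ forall x y : L, lmul x y <= p -> x <= p \/ y <= p].

Record Spec := MkSpec {
  spec_val : L;
  spec_valP : spec_val \in prime_element
}.

HB.instance Definition _ := [isSub for spec_val].
HB.instance Definition _ := [Choice of Spec by <:].

Definition zariskiV (x : L) : set Spec := [set p : Spec | x <= spec_val p].
Definition zariskiD (x : L) : set Spec := ~` zariskiV x.

Lemma zariskiDT : range zariskiD setT.
Proof.
exists \top => //; apply/seteqP; split=> // p _ /=; rewrite /zariskiV /= => tp.
have /set_mem[pT _] := spec_valP p.
by apply: pT; apply/eqP; rewrite -le1x.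
Qed.

Lemma zariskiDI : setI_closed (range zariskiD).
Proof.
move=> _ _ [x _ <-] [y _ <-]; exists (lmul x y) => //.
rewrite /zariskiD -setCU; congr (~` _); apply/seteqP; split=> p /=.
  by have /set_mem[_ +] := spec_valP p; apply.
by case; apply: le_trans; [exact: lmul_lel | exact: lmul_ler].
Qed.

Lemma zariskiD_bigU (I : Type) (f : I -> set Spec) :
  (forall i, range zariskiD (f i)) -> range zariskiD (\bigcup_i f i).
Proof.
move=> fD; have [ub lub] := bigsupP [set x | exists i, f i = zariskiD x].
exists (bigsup [set x | exists i, f i = zariskiD x]) => //.
rewrite /zariskiD; apply/seteqP; split=> p /=.
  apply: contra_notP => nfp; rewrite /zariskiV /=; apply: lub => x [i fx].
  by apply: contrapT => xp; apply: nfp; exists i => //; rewrite fx.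
move=> [i _ fip] supp; have [x _ fx] := fD i.
by move: fip; rewrite -fx; apply; apply: le_trans supp; apply: ub; exists i.
Qed.

HB.instance Definition _ :=
  isOpenTopological.Build Spec zariskiDT zariskiDI zariskiD_bigU.

Lemma closed_zariskiE (A : set Spec) :
  closed A <-> exists x : L, A = zariskiV x.
Proof.
rewrite -openC; split=> [[x _ DA] | [x ->]]; last by exists x.
by exists x; apply: setC_inj; rewrite -DA.
Qed.

Definition m_system (S : set L) : Prop :=
  [/\ S !=set0, S `<=` compact_element L &
      forall x y, S x -> S y -> exists2 z, S z & z <= lmul x y].

Definition saturated (S : set L) : Prop :=
  forall x c : L, S x -> compact_element L c -> x <= c -> S c.

Definition avoiding (Y : set Spec) : set L :=
  [set c | compact_element L c /\ forall p, Y p -> ~ (c <= spec_val p)].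

Definition specP (S : set L) : set Spec := \bigcap_(s in S) zariskiD s.

End MulLatticeDefs.

(* Main.v *)
Require Import Defs.
From mathcomp Require Import all_boot all_order.
From mathcomp Require Import boolp classical_sets topology.
From mathcomp Require Import functions cardinality finmap.

Import Order.TTheory.
Local Open Scope classical_set_scope.
Local Open Scope order_scope.

(** The key is a prime avoidance lemma: if no element of an m-system S lies below a, Zorn's
    lemma gives an element p maximal among those above a with no element of S below them (the
    elements of S being compact, this condition passes to joins of chains), and m-distributivity
    makes p prime. On the topological side, compactness of a subspace Y of the spectrum says that
    Y contained in D(\/ X) implies Y contained in D(\/ X0) for some finite subset X0 of X. *)

Lemma bigsup_ub {d : Order.disp_t} {L : completeLatticeType d} (X : set L) (x : L) :
  X x -> x <= bigsup X.
Proof. by have [+ _] := bigsupP X; apply. Qed.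

Lemma bigsup_le {d : Order.disp_t} {L : completeLatticeType d} (X : set L) (y : L) :
  ubound X y -> bigsup X <= y.
Proof. by have [_ +] := bigsupP X; apply. Qed.

Lemma bigsup_subset {d : Order.disp_t} {L : completeLatticeType d} (X Y : set L) :
  X `<=` Y -> bigsup X <= bigsup Y.
Proof. by move=> XY; apply: bigsup_le => x /XY; exact: bigsup_ub. Qed.

Lemma bigsup_finite_compact {d : Order.disp_t} {L : completeLatticeType d} (X : set L) :
  finite_set X -> X `<=` compact_element L -> compact_element L (bigsup X).
Proof.
move=> Xfin Xc Z XZ.
have /choice[F FP] (x : L) : exists F : set L,
    X x -> [/\ F `<=` Z, finite_set F & x <= bigsup F].
  have [Xx|nXx] := pselect (X x); last by exists set0.
  have [F FP] := Xc _ Xx Z (le_trans (bigsup_ub _ _ Xx) XZ).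
  by exists F.
exists (\bigcup_(x in X) F x); split.
- by move=> z [x Xx Fz]; have [+ _ _] := FP x Xx; apply.
- by apply: bigcup_finite => // x Xx; have [] := FP x Xx.
- apply: bigsup_le => x Xx; have [_ _ xF] := FP x Xx.
  by apply: (le_trans xF); apply: bigsup_subset => z Fz; exists x.
Qed.

Lemma finite_chain_ubound {d : Order.disp_t} {T : porderType d} (B X : set T) :
  total_on B <=%O -> B !=set0 -> X `<=` B -> finite_set X ->
  exists2 b, B b & ubound X b.
Proof.
move=> Btot [b0 Bb0] + /finite_seqP[s sE]; rewrite {X}sE.
(* The empty list is bounded by any member of [B], here [b0]. *)
elim: s => [_|x s IHs sB]; first by exists b0.
have [|b Bb sb] := IHs.
  by move=> y ys; apply: sB; rewrite /= inE; apply/orP; right.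
have Bx : B x by apply: sB; rewrite /= inE eqxx.
have [xb|bx] := Btot _ _ Bx Bb.
- exists b => // y; rewrite /= inE => /predU1P[-> //|]; exact: sb.
- exists x => // y; rewrite /= inE => /predU1P[-> //|ys].
  by apply: le_trans bx; exact: sb.
Qed.

Lemma compact_le_chain {d : Order.disp_t} {L : completeLatticeType d} (B : set L) (c : L) :
  compact_element L c -> total_on B <=%O -> B !=set0 -> c <= bigsup B ->
  exists2 b, B b & c <= b.
Proof.
move=> cc Btot B0 /cc[X [XB Xfin cX]].
have [b Bb Xb] := finite_chain_ubound _ _ Btot B0 XB Xfin.
by exists b => //; apply: (le_trans cX); exact: bigsup_le.
Qed.

Lemma exists_maximal_avoiding {d : Order.disp_t} {L : completeLatticeType d}
    (S : set L) (a : L) :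
  S `<=` compact_element L -> (forall s, S s -> ~ s <= a) ->
  exists p, [/\ a <= p, forall s, S s -> ~ s <= p &
                forall q, p < q -> exists2 s, S s & s <= q].
Proof.
move=> Sc Sa.
pose P : set L := [set x | a <= x /\ forall s, S s -> ~ s <= x].
pose R (u v : P) := val u <= val v.
have [|||A Atot|p pmax] := @Zorn P R.
- by move=> u; exact: lexx.
- by move=> u v w; exact: le_trans.
- by move=> u v uv vu; apply/val_inj/eqP; rewrite eq_le; apply/andP.
- (* Adjoining [a] makes the chain nonempty. *)
  pose B : set L := a |` (val @` A).
  have Pval (u : P) : P (val u) := set_mem (valP u).
  have BP : B `<=` P by move=> _ [->|[u _ <-]].
  have Btot : total_on B <=%O.
    move=> x y Bx By; have [[ax _] [ay _]] := (BP _ Bx, BP _ By).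
    case: Bx By ax ay => [->|[u Au <-]] [->|[v Av <-]] ax ay.
    + by left.
    + by left.
    + by right.
    + exact: Atot.
  have PB : P (bigsup B).
    split; first by apply: bigsup_ub; left.
    move=> s Ss sB; have [|b /BP[_ Pb] sb] := compact_le_chain _ _ (Sc _ Ss) Btot _ sB.
      by exists a; left.
    exact: Pb sb.
  exists (SigSub (mem_set PB)) => u Au; apply: bigsup_ub; right; by exists u.
- have [ap pS] := set_mem (valP p); exists (val p); split=> // q pq.
  (* Otherwise [q] would itself belong to [P], and maximality would force it to equal [p]. *)
  apply: contrapT => nq.
  have Pq : P q.
    split; first exact: le_trans (ltW pq).
    by move=> s Ss sq; apply: nq; exists s.
  have /(congr1 val)/= qp := pmax (SigSub (mem_set Pq)) (ltW pq).
  by move: pq; rewrite qp ltxx.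
Qed.

Section Spectrum.
Context {d : Order.disp_t} {L : mulLatticeType d}.

(** Monotonicity is not an axiom but comes from distributivity: if [x'] is the join of [x] and [x'],
    then $xy \leqslant xy \vee x'y = x'y$, and similarly on the right. *)
Lemma lmul_le2 (L_dist : m_distributive L) (x x' y y' : L) :
  x <= x' -> y <= y' -> lmul x y <= lmul x' y'.
Proof.
have [dl dr] := L_dist; move=> /join_idPr xx' /join_idPr yy'.
apply: (@le_trans _ _ (lmul x' y)).
- by rewrite -xx' dl leUl.
- by rewrite -yy' dr leUl.
Qed.

Lemma prime_avoidance (L_dist : m_distributive L) (S : set L) (a : L) :
  m_system S -> (forall s, S s -> ~ s <= a) ->
  exists2 p : Spec L, specP S p & a <= spec_val p.
Proof.
move=> [[s0 Ss0] Sc Sm] Sa.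
have [p [ap pS pmax]] := exists_maximal_avoiding _ _ Sc Sa.
have pprime : prime_element p.
  split=> [p1|x y xyp]; first by apply: (pS _ Ss0); rewrite p1 lex1.
  apply: contrapT => /not_orP[xp yp].
  have join_gt z : ~ z <= p -> p < p `|` z.
    by move=> zp; rewrite lt_neqAle leUl andbT; apply/eqP => pz; apply: zp; rewrite pz leUr.
  have [s Ss spx] := pmax _ (join_gt _ xp).
  have [t St tpy] := pmax _ (join_gt _ yp).
  have [z Sz zst] := Sm _ _ Ss St.
  (* Here $z \leqslant st \leqslant (p \vee x)(p \vee y) = pp \vee py \vee xp \vee xy$. The first
     three terms lie below one of their factors, namely [p], and the last one does by [xyp]. *)
  apply: (pS _ Sz); apply: (le_trans zst).
  apply: (le_trans (lmul_le2 L_dist _ _ _ _ spx tpy)).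
  have [dl dr] := L_dist.
  by rewrite dl !dr !leUx xyp !lmul_lel lmul_ler.
exists (MkSpec (mem_set pprime)) => //= s Ss; exact: pS.
Qed.

Lemma zariskiD_bigsup (X : set L) :
  zariskiD (bigsup X) = \bigcup_(x in X) zariskiD x.
Proof.
apply/seteqP; split=> p; last first.
  by move=> [x Xx xp] Xp; apply: xp; exact: le_trans (bigsup_ub _ _ Xx) Xp.
move=> Xp; apply: contrapT => np; apply: Xp; apply: bigsup_le => x Xx.
by apply: contrapT => xp; apply: np; exists x.
Qed.

Lemma zariskiD_sub (x y : L) : x <= y -> zariskiD x `<=` zariskiD y.
Proof. by move=> xy p xp yp; apply: xp; exact: le_trans yp. Qed.

Lemma zariskiD_lmul (x y : L) :
  zariskiD x `&` zariskiD y `<=` zariskiD (lmul x y).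
Proof.
move=> p [xp yp] xyp; have /set_mem[_ /(_ _ _ xyp)] := spec_valP p.
by case.
Qed.

Lemma open_zariskiP (A : set (Spec L)) : open A <-> exists x : L, A = zariskiD x.
Proof.
by split=> [[x _ <-]|[x ->]]; exists x.
Qed.

Lemma open_set_type_zariskiP (Y : set (Spec L)) (U : set (set_type Y)) :
  open U <-> exists x : L, U = set_val @^-1` zariskiD x.
Proof.
split=> [[_ [x _ <-] <-]|[x ->]]; first by exists x.
by exists (zariskiD x) => //; apply/open_zariskiP; exists x.
Qed.

(** Every open set of the subspace is the trace of some $\mathrm{D}(x)$, and $\mathrm{D}$ turns
    joins into unions, so an open cover amounts to a set of elements of [L]. *)
Lemma compact_subspecP (Y : set (Spec L)) :
  cover_compact [set: set_type Y] <->
  forall X : set L, Y `<=` zariskiD (bigsup X) ->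
    exists X0, [/\ X0 `<=` X, finite_set X0 & Y `<=` zariskiD (bigsup X0)].
Proof.
split=> [cY X YX|cY I D f fo fcover].
  have [x Xx||X0 X0X YX0] := cY L X (fun x => set_val @^-1` zariskiD x).
  - by apply/open_set_type_zariskiP; exists x.
  - move=> p _; have := YX _ (set_valP p); rewrite zariskiD_bigsup.
    by move=> [x Xx xp]; exists x.
  exists [set` X0]; split; [by move=> x /X0X/set_mem|exact: finite_fset|].
  rewrite zariskiD_bigsup => p Yp.
  by have [x X0x xp] := YX0 (SigSub (mem_set Yp)) Logic.I; exists x.
have /choice[g gP] (i : I) : exists x : L, D i -> f i = set_val @^-1` zariskiD x.
  have [Di|nDi] := pselect (D i); last by exists \bot.
  by have /open_set_type_zariskiP[x ->] := fo _ Di; exists x.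
have [|X0 [X0D X0fin YX0]] := cY (g @` D).
  rewrite zariskiD_bigsup => p Yp.
  have [i Di] := fcover (SigSub (mem_set Yp)) Logic.I.
  by rewrite gP // => ip; exists (g i) => //; exists i.
(* Pull the finite set [X0] back to indices. The type [I] may be empty, so [None] is the value of
   [h] outside [X0]. *)
have /choice[h hP] (x : L) : exists i : option I,
    X0 x -> exists2 j, i = Some j & D j /\ g j = x.
  have [X0x|nX0x] := pselect (X0 x); last by exists None.
  by have [j Dj gj] := X0D _ X0x; exists (Some j) => _; exists j.
pose J : set I := Some @^-1` (h @` X0).
have Jfin : finite_set J.
  by apply: finite_preimage; [move=> i j _ _ []|exact: finite_image].
exists (fset_set J).
  move=> i; rewrite in_fset_set// => /set_mem[x X0x hx].
  by apply/mem_set; have [j] := hP _ X0x; rewrite hx => -[->] [].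
move=> p _; have := YX0 _ (set_valP p); rewrite zariskiD_bigsup => -[x X0x xp].
have [i hx [Di gi]] := hP _ X0x; exists i; last by rewrite gP //= gi.
by rewrite fset_setK//; exists x.
Qed.

(** By prime avoidance, a cover forces some [s] in [S] below [bigsup X]. Compactness of [s] then
    gives a finite [X0], which suffices because [specP S] is contained in $\mathrm{D}(s)$. *)
Lemma m_system_specP_compact (L_dist : m_distributive L) (S : set L) :
  m_system S -> cover_compact [set: set_type (specP S)].
Proof.
move=> Sm; apply/compact_subspecP => X SX.
have [s Ss sX] : exists2 s, S s & s <= bigsup X.
  apply: contrapT => ns; have [|p Sp pX] := prime_avoidance L_dist _ (bigsup X) Sm.
    by move=> s Ss sX; apply: ns; exists s.
  exact: SX Sp pX.
have [_ Sc _] := Sm; have [X0 [X0X X0fin sX0]] := Sc _ Ss _ sX.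
by exists X0; split=> // p Sp; apply: zariskiD_sub sX0 _ (Sp _ Ss).
Qed.

Lemma saturated_m_system_avoiding (L_dist : m_distributive L) (S : set L) :
  m_system S -> saturated S -> S = avoiding (specP S).
Proof.
move=> Sm Ssat; have [_ Sc _] := Sm.
apply/seteqP; split=> c.
  by move=> Sc'; split; [exact: Sc|move=> p; exact].
(* By saturation no element of [S] lies below [c], so prime avoidance yields a point of [specP S]
   above [c]. *)
move=> [cc cP]; apply: contrapT => nSc.
have [s Ss sc|p Sp cp] := prime_avoidance L_dist _ c Sm; last exact: cP Sp cp.
by apply: nSc; exact: Ssat Ss cc sc.
Qed.

Lemma avoiding_saturated (Y : set (Spec L)) : saturated (avoiding Y).
Proof.
by move=> x c [_ xY] cc xc; split=> // p Yp cp; apply: xY Yp _; exact: le_trans cp.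
Qed.

(** Write [x] as a join of compact elements: finitely many of them already cover [Y], and their join
    is compact. *)
Lemma compact_exists_avoiding (L_alg : algebraic_lattice L) (Y : set (Spec L)) (x : L) :
  cover_compact [set: set_type Y] -> Y `<=` zariskiD x ->
  exists2 c, avoiding Y c & c <= x.
Proof.
move=> /compact_subspecP cY; have [X Xc ->] := L_alg x => /cY[X0 [X0X X0fin YX0]].
exists (bigsup X0); last exact: bigsup_subset.
split=> //; apply: bigsup_finite_compact => // y /X0X; exact: Xc.
Qed.

Lemma avoiding_m_system (L_alg : algebraic_lattice L) (Y : set (Spec L)) :
  cover_compact [set: set_type Y] -> m_system (avoiding Y).
Proof.
move=> cY; split.
- have [|c Yc _] := compact_exists_avoiding L_alg _ \top cY; last by exists c.
  move=> p _ p1; have /set_mem[+ _] := spec_valP p; apply.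
  by apply/eqP; rewrite -le1x.
- by move=> c [].
(* The product [lmul x y] need not be compact, so a compact element below it that still avoids [Y]
   is taken. *)
- move=> x y [_ xY] [_ yY]; apply: compact_exists_avoiding => // p Yp.
  by apply: zariskiD_lmul; split; [exact: xY|exact: yY].
Qed.

End Spectrum.

Local Close Scope order_scope.

Theorem theorem6p3 (d : Order.disp_t) (L : mulLatticeType d)
    (L_alg : algebraic_lattice L) (L_dist : m_distributive L)
    (S : set L) (S_cpt : S `<=` compact_element L) :
  (m_system S /\ saturated S)
  <->
  (cover_compact [set: set_type (specP S)] /\ S = avoiding (specP S)).
Proof.
split=> [[Sm Ssat]|[cS ->]].
  by split; [exact: m_system_specP_compact|exact: saturated_m_system_avoiding].
by split; [exact: avoiding_m_system|exact: avoiding_saturated].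
Qed.
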